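(* (1) $k\mathbf{FS}^0$ forms a wide $k$-linear subcategory of $k\mathbf{FS}$ (i.e. a $k$-linear subcategory containing all objects). (2) $k\mathbf{FS}$ has the structure of a $k\mathbf{FS}^0\otimes k\mathbf{FI}^{\mathrm{op}}$-module, where $k\mathbf{FS}^0$ acts by postcomposition in $k\mathbf{FS}$ and $k\mathbf{FI}^{\mathrm{op}}$ acts by restriction, and $$0=k\mathbf{FS}^{-1}\subseteq k\mathbf{FS}^0\subseteq k\mathbf{FS}^1\subseteq k\mathbf{FS}^2\subseteq\cdots\subseteq k\mathbf{FS}$$ is a filtration by $k\mathbf{FS}^0\otimes k\mathbf{FI}^{\mathrm{op}}$-modules.
   Context: $k$ is a field of characteristic zero. $\mathbf{FS}$, $\mathbf{FI}$ are the categories of finite sets with, respectively, surjections and injections as morphisms. For a category $\mathcal C$, $k\mathcal C$ is its $k$-linearization (same objects, $k\mathcal C(X,Y)$ the vector space with basis $\{[f] : f\in\mathcal C(X,Y)\}$). A module over a $k$-linear category $\mathcal A$ is a $k$-linear functor from $\mathcal A$ to $k$-vector spaces. For $k$-linear categories $\mathcal A,\mathcal B$, $\mathcal A\otimes\mathcal B$ has as objects pairs of objects and as morphism spaces the tensor products of morphism spaces. For a finite set $X$, $k\mathbf{FS}(-,X)$ is a $k\mathbf{FI}^{\mathrm{op}}$-module by restriction: for an injection $i:V\hookrightarrow U$ and a surjection $f:U\twoheadrightarrow X$, $i^*[f]=[f\circ i]$ if $f\circ i$ is surjective and $i^*[f]=0$ otherwise. Filtration: for $t\geq -1$ an integer and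 finite sets $U,X$, $k\mathbf{FS}^t(U,X)\subseteq k\mathbf{FS}(U,X)$ is the subspace of elements $x$ such that $i^*x=0$ for every finite set $V$ with $|U|-|V|=t+1$ and every injection $i:V\hookrightarrow U$ (so it is all of $k\mathbf{FS}(U,X)$ if $|U|\leq t$). In particular $k\mathbf{FS}^0(U,X)$ consists of the elements killed by restriction along all injections $V\hookrightarrow U$ with $|V|=|U|-1$. *)

(* Defs.v *)
From HB Require Import structures.
From mathcomp Require Import all_boot all_order all_algebra.
From mathcomp Require Import boolp.

Set Implicit Arguments.
Unset Strict Implicit.
Unset Printing Implicit Defensive.

Import Order.TTheory GRing.Theory Num.Theory.
Local Open Scope ring_scope.
Local Open Scope quotient_scope.

Section TensorProduct.

Variable k : fieldType.

Definition bilinear_map (V W Z : lmodType k) (b : V -> W -> Z) : Prop :=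
  (forall v, linear (b v)) /\ (forall w, linear (b^~ w)).

Section Construction.

Variables V W : lmodType k.

Definition formal_eval (Z : lmodType k) (b : V -> W -> Z) (s : seq (V * W)) : Z :=
  \sum_(p <- s) b p.1 p.2.

(* V (x) W is presented as the formal sums of pairs (v, w), two of them being
   identified when no bilinear map to a k-vector space separates them.
   tens_lift_pure, tens_lift_linear and tens_ext give its universal property. *)
Definition formal_eq : rel (seq (V * W)) := fun s t =>
  `[< forall (Z : lmodType k) (b : V -> W -> Z),
        bilinear_map b -> formal_eval b s = formal_eval b t >].

Lemma formal_eq_refl : reflexive formal_eq.
Proof. by move=> s; apply/asboolP. Qed.

Lemma formal_eq_sym : symmetric formal_eq.
Proof. by move=> s t; apply/asboolP/asboolP => st Z b /st ->. Qed.

Lemma formal_eq_trans : transitive formal_eq.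
Proof.
move=> t s u /asboolP st /asboolP tu; apply/asboolP => Z b hb.
by rewrite st // tu.
Qed.

Canonical formal_equiv := EquivRel formal_eq
  formal_eq_refl formal_eq_sym formal_eq_trans.

Definition tens : Type := {eq_quot formal_eq}.

HB.instance Definition _ := Choice.on tens.
HB.instance Definition _ := EqQuotient.on tens.

Definition tens_lift (Z : lmodType k) (b : V -> W -> Z) (s : tens) : Z :=
  formal_eval b (repr s).

Definition pure (v : V) (w : W) : tens := \pi_tens [:: (v, w)].

Definition tens_zero : tens := \pi_tens [::].
Definition tens_add (s t : tens) : tens := \pi_tens (repr s ++ repr t).
Definition tens_scale (a : k) (s : tens) : tens :=
  \pi_tens [seq (a *: p.1, p.2) | p <- repr s].
Definition tens_opp (s : tens) : tens := tens_scale (-1) s.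

Lemma tens_liftE (Z : lmodType k) (b : V -> W -> Z) s :
  bilinear_map b -> tens_lift b (\pi_tens s) = formal_eval b s.
Proof.
move=> hb; have /eqmodP/asboolP : repr (\pi_tens s) = s %[mod tens] by rewrite reprK.
exact.
Qed.

Lemma tens_eqP (s t : tens) :
  (forall (Z : lmodType k) (b : V -> W -> Z),
     bilinear_map b -> tens_lift b s = tens_lift b t) -> s = t.
Proof.
move=> h; rewrite -[s]reprK -[t]reprK; apply/eqmodP/asboolP => Z b hb.
exact: h.
Qed.

Section LiftOps.
Variables (Z : lmodType k) (b : V -> W -> Z).
Hypothesis hb : bilinear_map b.

Lemma tens_lift0 : tens_lift b tens_zero = 0.
Proof. by rewrite tens_liftE // /formal_eval big_nil. Qed.

Lemma tens_liftD s t :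
  tens_lift b (tens_add s t) = tens_lift b s + tens_lift b t.
Proof. by rewrite tens_liftE // /formal_eval big_cat. Qed.

Lemma bilinear_mapZl a v w : b (a *: v) w = a *: b v w.
Proof.
have h0 : b 0 w = 0.
  have := hb.2 w 0 0 0; rewrite /= !scale0r !add0r => E.
  by have := hb.2 w 1 0 0; rewrite /= !scale1r addr0 => /eqP;
    rewrite -{1}[b 0 w]addr0 (inj_eq (addrI _)) => /eqP <-.
by have := hb.2 w a v 0; rewrite /= addr0 h0 addr0.
Qed.

Lemma tens_liftZ a s : tens_lift b (tens_scale a s) = a *: tens_lift b s.
Proof.
rewrite tens_liftE // /formal_eval big_map /tens_lift /formal_eval scaler_sumr.
by apply: eq_bigr => p _; rewrite /= bilinear_mapZl.
Qed.

Lemma tens_liftN s : tens_lift b (tens_opp s) = - tens_lift b s.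
Proof. by rewrite tens_liftZ scaleN1r. Qed.

Lemma tens_lift_pure v w : tens_lift b (pure v w) = b v w.
Proof. by rewrite tens_liftE // /formal_eval big_seq1. Qed.

End LiftOps.

Lemma tens_addA : associative tens_add.
Proof. by move=> s t u; apply: tens_eqP => Z b hb; rewrite !tens_liftD // addrA. Qed.
Lemma tens_addC : commutative tens_add.
Proof. by move=> s t; apply: tens_eqP => Z b hb; rewrite !tens_liftD // addrC. Qed.
Lemma tens_add0 : left_id tens_zero tens_add.
Proof. by move=> s; apply: tens_eqP => Z b hb; rewrite tens_liftD // tens_lift0 // add0r. Qed.
Lemma tens_addN : left_inverse tens_zero tens_opp tens_add.
Proof.
by move=> s; apply: tens_eqP => Z b hb; rewrite tens_liftD // tens_liftN // addNr tens_lift0.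
Qed.

HB.instance Definition _ :=
  GRing.isZmodule.Build tens tens_addA tens_addC tens_add0 tens_addN.

Lemma tens_scaleA a b s : tens_scale a (tens_scale b s) = tens_scale (a * b) s.
Proof. by apply: tens_eqP => Z f hf; rewrite !tens_liftZ // scalerA. Qed.
Lemma tens_scale1 : left_id 1 tens_scale.
Proof. by move=> s; apply: tens_eqP => Z b hb; rewrite tens_liftZ // scale1r. Qed.
Lemma tens_scaleDr : right_distributive tens_scale +%R.
Proof.
move=> a s t; apply: tens_eqP => Z b hb.
by rewrite tens_liftZ // !tens_liftD // scalerDr !tens_liftZ.
Qed.
Lemma tens_scaleDl s : {morph tens_scale^~ s : a b / a + b}.
Proof.
move=> a b; apply: tens_eqP => Z f hf.
by rewrite tens_liftD // !tens_liftZ // scalerDl.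
Qed.

HB.instance Definition _ := GRing.Zmodule_isLmodule.Build k tens
  tens_scaleA tens_scale1 tens_scaleDr tens_scaleDl.

Lemma tens_lift_linear (Z : lmodType k) (b : V -> W -> Z) :
  bilinear_map b -> linear (tens_lift b).
Proof. by move=> hb a s t; rewrite tens_liftD // tens_liftZ. Qed.

Lemma pure_bilinear : bilinear_map pure.
Proof.
split=> [v a w w'|w a v v']; apply: tens_eqP => Z b hb;
  rewrite tens_lift_linear // !tens_lift_pure //; [exact: hb.1 | exact: hb.2].
Qed.

Lemma tens_sum (s : tens) : s = \sum_(p <- repr s) pure p.1 p.2.
Proof.
apply: tens_eqP => Z b hb; rewrite {1}/tens_lift /formal_eval.
elim: (repr s) => [|p r IH]; first by rewrite !big_nil tens_lift0.
by rewrite !big_cons IH tens_liftD // tens_lift_pure.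
Qed.

Lemma tens_ext (Z : lmodType k) (f g : tens -> Z) :
  linear f -> linear g -> (forall v w, f (pure v w) = g (pure v w)) -> f =1 g.
Proof.
move=> hf hg fg s.
have lin0 (h : tens -> Z) : linear h -> h 0 = 0.
  move=> hh; have /eqP := hh 1 0 0.
  by rewrite !scale1r addr0 -{1}[h 0]addr0 (inj_eq (addrI _)) => /eqP.
rewrite [s]tens_sum; elim: (repr s) => [|p r IH].
  by rewrite !big_nil !lin0.
by rewrite !big_cons -[pure _ _]scale1r hf hg fg IH.
Qed.

End Construction.

Lemma bilinear_comp (V W Z Z' : lmodType k) (b : V -> W -> Z) (f : Z -> Z') :
  linear f -> bilinear_map b -> bilinear_map (fun v w => f (b v w)).
Proof. by move=> hf [b1 b2]; split=> [v|w] a x y; rewrite /= ?b1 ?b2 ?hf. Qed.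

End TensorProduct.

Arguments pure {k V W}.

Section LinearCategories.

Variable k : fieldType.

Record klincat := KLinCat {
  kob :> Type;
  khom : kob -> kob -> lmodType k;
  kid : forall X, khom X X;
  kcomp : forall X Y Z, khom Y Z -> khom X Y -> khom X Z;
  kcomp_bilinear : forall X Y Z, bilinear_map (@kcomp X Y Z);
  kcompA : forall X Y Z T (h : khom Z T) (g : khom Y Z) (f : khom X Y),
    kcomp h (kcomp g f) = kcomp (kcomp h g) f;
  kcomp1l : forall X Y (f : khom X Y), kcomp (kid Y) f = f;
  kcomp1r : forall X Y (f : khom X Y), kcomp f (kid X) = f
}.

Arguments kid {_} X.
Arguments kcomp {_ X Y Z}.

Section Subcategory.

Variables (A : klincat) (S : forall X Y : A, {pred khom X Y}).
Arguments S : clear implicits.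

Definition wide_linear_subcategory : Prop :=
  [/\ forall X Y, submod_closed (S X Y),
      forall X, kid X \in S X X
    & forall X Y Z (g : khom Y Z) (f : khom X Y),
        g \in S Y Z -> f \in S X Y -> kcomp g f \in S X Z].

End Subcategory.

Section SubSpace.

Variables (V : lmodType k) (S : {pred V}).

Definition subspace (h : submod_closed S) : Type := {v : V | v \in S}.

Variable h : submod_closed S.

HB.instance Definition _ := SubChoice.on (subspace h).

Lemma subspace_closed : subsemimod_closed (fun v : V => v \in S).
Proof. exact: GRing.submod_closed_semi. Qed.

HB.instance Definition _ := GRing.SubChoice_isSubLmodule.Build
  k V (fun v : V => v \in S) (subspace h) subspace_closed.

End SubSpace.

Section SubcategoryAsCategory.

Variables (A : klincat) (S : forall X Y : A, {pred khom X Y}).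
Arguments S : clear implicits.
Variable h : wide_linear_subcategory S.

Lemma wide_hom X Y : submod_closed (S X Y). Proof. by case: h. Qed.
Lemma wide_id X : kid X \in S X X. Proof. by case: h. Qed.
Lemma wide_comp X Y Z (g : khom Y Z) (f : khom X Y) :
  g \in S Y Z -> f \in S X Y -> kcomp g f \in S X Z.
Proof. by case: h => _ _; apply. Qed.

Definition sub_hom (X Y : A) : lmodType k := subspace (wide_hom X Y).
Definition sub_id (X : A) : sub_hom X X := exist _ (kid X) (wide_id X).
Definition sub_comp (X Y Z : A) (g : sub_hom Y Z) (f : sub_hom X Y) :
  sub_hom X Z := exist _ (kcomp (val g) (val f)) (wide_comp (valP g) (valP f)).

Lemma sub_comp_bilinear X Y Z : bilinear_map (@sub_comp X Y Z).
Proof.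
have [h1 h2] := @kcomp_bilinear A X Y Z.
by split=> [g|f] a u v; apply: val_inj; rewrite /= ?linearP /= ?h1 ?h2.
Qed.

Lemma sub_compA X Y Z T (p : sub_hom Z T) (g : sub_hom Y Z) (f : sub_hom X Y) :
  sub_comp p (sub_comp g f) = sub_comp (sub_comp p g) f.
Proof. by apply: val_inj; apply: kcompA. Qed.

Lemma sub_comp1l X Y (f : sub_hom X Y) : sub_comp (sub_id Y) f = f.
Proof. by apply: val_inj; apply: kcomp1l. Qed.

Lemma sub_comp1r X Y (f : sub_hom X Y) : sub_comp f (sub_id X) = f.
Proof. by apply: val_inj; apply: kcomp1r. Qed.

Definition subcat : klincat :=
  KLinCat sub_comp_bilinear sub_compA sub_comp1l sub_comp1r.

End SubcategoryAsCategory.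

Section TensorCategory.

Variables A B : klincat.

Let tob : Type := (A * B)%type.
Definition tensor_hom (c d : tob) : lmodType k :=
  tens (khom c.1 d.1) (khom c.2 d.2).
Definition tensor_id (c : tob) : tensor_hom c c := pure (kid c.1) (kid c.2).
Definition tensor_comp (c d e : tob) (s : tensor_hom d e) (t : tensor_hom c d) :
    tensor_hom c e :=
  tens_lift (fun g g' => tens_lift (fun f f' => pure (kcomp g f) (kcomp g' f')) t) s.

Lemma tensor_comp_bil1 (c d e : tob) g g' :
  bilinear_map (fun (f : khom c.1 d.1) (f' : khom c.2 d.2) =>
    (pure (kcomp g f) (kcomp g' f') : tensor_hom c e)).
Proof.
have [p1 p2] := pure_bilinear (khom c.1 e.1) (khom c.2 e.2).
have [a1 a2] := @kcomp_bilinear A c.1 d.1 e.1.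
have [b1 b2] := @kcomp_bilinear B c.2 d.2 e.2.
by split=> [f|f'] a x y; rewrite ?a1 ?b1 ?p1 // p2.
Qed.

Lemma tensor_comp_bil2 (c d e : tob) (t : tensor_hom c d) :
  bilinear_map (fun (g : khom d.1 e.1) (g' : khom d.2 e.2) =>
    tens_lift (fun f f' => (pure (kcomp g f) (kcomp g' f') : tensor_hom c e)) t).
Proof.
have [p1 p2] := pure_bilinear (khom c.1 e.1) (khom c.2 e.2).
have [a1 a2] := @kcomp_bilinear A c.1 d.1 e.1.
have [b1 b2] := @kcomp_bilinear B c.2 d.2 e.2.
split=> [g|g'] a x y; rewrite /tens_lift /formal_eval scaler_sumr -big_split;
  apply: eq_bigr => p _ /=.
  by have /= -> := b2 p.2 a x y; rewrite p1.
by have /= -> := a2 p.1 a x y; have /= -> := p2 (kcomp g' p.2) a (kcomp x p.1) (kcomp y p.1).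
Qed.

Lemma tensor_comp_bilinear c d e : bilinear_map (@tensor_comp c d e).
Proof.
split=> [s|t]; last first.
  exact: (tens_lift_linear (tensor_comp_bil2 e t)).
move=> a x y; rewrite /tensor_comp {1 3 5}/tens_lift /formal_eval scaler_sumr -big_split.
by apply: eq_bigr => p _ /=; rewrite tens_lift_linear //; apply: tensor_comp_bil1.
Qed.

Lemma tensor_comp_pure (c d e : tob) (g : khom d.1 e.1) (g' : khom d.2 e.2)
    (f : khom c.1 d.1) (f' : khom c.2 d.2) :
  tensor_comp (pure g g' : tensor_hom d e) (pure f f' : tensor_hom c d)
    = pure (kcomp g f) (kcomp g' f').
Proof.
rewrite /tensor_comp tens_lift_pure; last exact: tensor_comp_bil2.
by rewrite tens_lift_pure //; apply: tensor_comp_bil1.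
Qed.

Lemma tensor_compA c d e r (u : tensor_hom e r) (s : tensor_hom d e)
    (t : tensor_hom c d) :
  tensor_comp u (tensor_comp s t) = tensor_comp (tensor_comp u s) t.
Proof.
have bl x y z := (@tensor_comp_bilinear x y z).1.
have br x y z := (@tensor_comp_bilinear x y z).2.
move: u; apply: tens_ext => [a x y|a x y|g g'].
- exact: br.
- have /= -> := br _ _ _ s a x y; exact: br.
move: s; apply: tens_ext => [a x y|a x y|f f'].
- have /= -> := br _ _ _ t a x y; exact: bl.
- have /= -> := bl _ _ _ (pure g g' : tensor_hom e r) a x y; exact: br.
move: t; apply: tens_ext => [a x y|a x y|p p'].
- have /= -> := bl _ _ _ (pure f f' : tensor_hom d e) a x y; exact: bl.
- exact: bl.
by rewrite !tensor_comp_pure !kcompA.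
Qed.

Lemma tensor_comp1l c d (s : tensor_hom c d) : tensor_comp (tensor_id d) s = s.
Proof.
move: s; apply: tens_ext => [a x y|a x y|f f'] //.
  exact: (@tensor_comp_bilinear c d d).1.
by rewrite tensor_comp_pure !kcomp1l.
Qed.

Lemma tensor_comp1r c d (s : tensor_hom c d) : tensor_comp s (tensor_id c) = s.
Proof.
move: s; apply: tens_ext => [a x y|a x y|f f'] //.
  exact: (@tensor_comp_bilinear c c d).2.
by rewrite tensor_comp_pure !kcomp1r.
Qed.

Definition tensor_cat : klincat :=
  KLinCat tensor_comp_bilinear tensor_compA tensor_comp1l tensor_comp1r.

End TensorCategory.

Section Modules.

Variables (A : klincat) (M : A -> lmodType k).
Variable act : forall X Y : A, khom X Y -> M X -> M Y.

(* (M, act) is a k-linear functor from A to k-vector spaces. *)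
Definition is_module : Prop :=
  [/\ forall X Y, bilinear_map (@act X Y),
      forall X (x : M X), act (kid X) x = x
    & forall X Y Z (g : khom Y Z) (f : khom X Y) (x : M X),
        act (kcomp g f) x = act g (act f x)].

Definition is_submodule (N : forall X, {pred M X}) : Prop :=
  (forall X, submod_closed (N X)) /\
  (forall X Y (f : khom X Y) (x : M X), x \in N X -> act f x \in N Y).

Definition is_filtration (F : int -> forall X, {pred M X}) : Prop :=
  [/\ forall X (x : M X), (x \in F (-1) X) = (x == 0),
      forall t, -1 <= t -> is_submodule (F t),
      forall t, -1 <= t -> forall X, {subset F t X <= F (t + 1) X}
    & forall X (x : M X), exists2 t, -1 <= t & x \in F t X].

End Modules.

End LinearCategories.

Arguments kid {_ _} X.
Arguments kcomp {_ _ X Y Z}.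

(* Categories with finite hom-sets, which suffices for FS and FI: the
   linearization then has all functions on a hom-set as morphisms. *)
Record fincat := FinCat {
  fob :> Type;
  fmor : fob -> fob -> finType;
  fid : forall X, fmor X X;
  fcomp : forall X Y Z, fmor Y Z -> fmor X Y -> fmor X Z;
  fcompA : forall X Y Z T (h : fmor Z T) (g : fmor Y Z) (f : fmor X Y),
    fcomp h (fcomp g f) = fcomp (fcomp h g) f;
  fcomp1l : forall X Y (f : fmor X Y), fcomp (fid Y) f = f;
  fcomp1r : forall X Y (f : fmor X Y), fcomp f (fid X) = f
}.

Arguments fid {_} X.
Arguments fcomp {_ X Y Z}.

Definition op_cat (C : fincat) : fincat :=
  @FinCat C (fun X Y => fmor Y X) (fun X => fid X)
    (fun X Y Z g f => fcomp f g)
    (fun X Y Z T h g f => esym (fcompA f g h))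
    (fun X Y f => fcomp1r f) (fun X Y f => fcomp1l f).

Section Linearization.

Variables (k : fieldType) (C : fincat).

Definition lin_hom (X Y : C) : lmodType k := {ffun fmor X Y -> k^o}.

Definition lin_basis (X Y : C) (f : fmor X Y) : lin_hom X Y :=
  [ffun g => (g == f)%:R].

Definition lin_id (X : C) : lin_hom X X := lin_basis (fid X).

Definition lin_comp (X Y Z : C) (y : lin_hom Y Z) (x : lin_hom X Y) :
    lin_hom X Z :=
  \sum_(g : fmor Y Z) \sum_(f : fmor X Y) (y g * x f) *: lin_basis (fcomp g f).

Lemma lin_comp_bilinear X Y Z : bilinear_map (@lin_comp X Y Z).
Proof.
split=> [y|x] a u v; rewrite /lin_comp scaler_sumr -big_split;
  apply: eq_bigr => g _ /=; rewrite scaler_sumr -big_split; apply: eq_bigr => f _ /=;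
  rewrite !ffunE scalerA -scalerDl; congr (_ *: _).
  by rewrite mulrDr mulrCA.
by rewrite mulrDl -mulrA.
Qed.

Lemma lin_sum X Y (x : lin_hom X Y) : x = \sum_f x f *: lin_basis f.
Proof.
apply/ffunP => g; rewrite sum_ffunE (bigD1 g) //= big1 => [|f /negPf fg].
  by rewrite !ffunE eqxx addr0 [_ *: _]mulr1.
by rewrite !ffunE eq_sym fg scaler0.
Qed.

Lemma lin_ext X Y (Z : lmodType k) (F G : lin_hom X Y -> Z) :
  linear F -> linear G -> (forall f, F (lin_basis f) = G (lin_basis f)) -> F =1 G.
Proof.
move=> hF hG FG x.
have lin0 (h : lin_hom X Y -> Z) : linear h -> h 0 = 0.
  move=> hh; have /eqP := hh 1 0 0.
  by rewrite !scale1r addr0 -{1}[h 0]addr0 (inj_eq (addrI _)) => /eqP.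
rewrite [x]lin_sum; elim: (index_enum _) => [|p r IH].
  by rewrite !big_nil !lin0.
by rewrite !big_cons hF hG FG IH.
Qed.

Lemma lin_comp_basis X Y Z (g : fmor Y Z) (f : fmor X Y) :
  lin_comp (lin_basis g) (lin_basis f) = lin_basis (fcomp g f).
Proof.
rewrite /lin_comp (bigD1 g) //= [X in _ + X]big1 => [|g' /negPf g'g]; last first.
  by rewrite big1 // => f' _; rewrite ffunE g'g mul0r scale0r.
rewrite addr0 (bigD1 f) //= big1 => [|f' /negPf f'f].
  by rewrite !ffunE !eqxx mulr1 scale1r addr0.
by rewrite [X in _ * X]ffunE f'f mulr0 scale0r.
Qed.

Lemma lin_compA X Y Z T (h : lin_hom Z T) (g : lin_hom Y Z) (f : lin_hom X Y) :
  lin_comp h (lin_comp g f) = lin_comp (lin_comp h g) f.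
Proof.
have bl x y z := (@lin_comp_bilinear x y z).1.
have br x y z := (@lin_comp_bilinear x y z).2.
move: h; apply: lin_ext => [a x y|a x y|h].
- exact: br.
- have /= -> := br _ _ _ g a x y; exact: br.
move: g; apply: lin_ext => [a x y|a x y|g].
- have /= -> := br _ _ _ f a x y; exact: bl.
- rewrite bl; exact: br.
move: f; apply: lin_ext => [a x y|a x y|f].
- rewrite bl; exact: bl.
- exact: bl.
by rewrite !lin_comp_basis fcompA.
Qed.

Lemma lin_comp1l X Y (f : lin_hom X Y) : lin_comp (lin_id Y) f = f.
Proof.
move: f; apply: lin_ext => [a x y|a x y|f] //.
  exact: (@lin_comp_bilinear X Y Y).1.
by rewrite lin_comp_basis fcomp1l.
Qed.

Lemma lin_comp1r X Y (f : lin_hom X Y) : lin_comp f (lin_id X) = f.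
Proof.
move: f; apply: lin_ext => [a x y|a x y|f] //.
  exact: (@lin_comp_bilinear X X Y).2.
by rewrite lin_comp_basis fcomp1r.
Qed.

Definition lin_cat : klincat k :=
  KLinCat lin_comp_bilinear lin_compA lin_comp1l lin_comp1r.

End Linearization.

Definition surjectiveb (U X : finType) (f : {ffun U -> X}) : bool :=
  [forall x, exists u, f u == x].

Lemma surjectivebP (U X : finType) (f : {ffun U -> X}) :
  reflect (forall x, exists u, f u = x) (surjectiveb f).
Proof. exact: 'forall_'exists_eqP. Qed.

Definition surjection (U X : finType) : finType :=
  {f : {ffun U -> X} | surjectiveb f}.
Definition injection (V U : finType) : finType :=
  {i : {ffun V -> U} | injectiveb i}.

Definition ffcomp (U V W : finType) (g : {ffun V -> W}) (f : {ffun U -> V}) :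
  {ffun U -> W} := [ffun u => g (f u)].

Lemma surj_id (X : finType) : surjectiveb [ffun x : X => x].
Proof. by apply/surjectivebP => x; exists x; rewrite ffunE. Qed.

Lemma surj_comp (U V W : finType) (g : surjection V W) (f : surjection U V) :
  surjectiveb (ffcomp (val g) (val f)).
Proof.
apply/surjectivebP => w; have [v <-] := surjectivebP _ (valP g) w.
by have [u <-] := surjectivebP _ (valP f) v; exists u; rewrite ffunE.
Qed.

Lemma inj_id (X : finType) : injectiveb [ffun x : X => x].
Proof. by apply/injectiveP => x y; rewrite !ffunE. Qed.

Lemma inj_comp (U V W : finType) (g : injection V W) (f : injection U V) :
  injectiveb (ffcomp (val g) (val f)).
Proof.
apply/injectiveP => x y; rewrite !ffunE.
by move=> /(injectiveP _ (valP g)) /(injectiveP _ (valP f)).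
Qed.

Definition FS_id (X : finType) : surjection X X := exist _ [ffun x => x] (surj_id X).
Definition FS_comp (X Y Z : finType) (g : surjection Y Z) (f : surjection X Y) :
  surjection X Z := exist _ (ffcomp (val g) (val f)) (surj_comp g f).

Definition FI_id (X : finType) : injection X X := exist _ [ffun x => x] (inj_id X).
Definition FI_comp (X Y Z : finType) (g : injection Y Z) (f : injection X Y) :
  injection X Z := exist _ (ffcomp (val g) (val f)) (inj_comp g f).

Lemma ffcompA (U V W X : finType) (h : {ffun W -> X}) (g : {ffun V -> W})
  (f : {ffun U -> V}) : ffcomp h (ffcomp g f) = ffcomp (ffcomp h g) f.
Proof. by apply/ffunP => u; rewrite !ffunE. Qed.

Lemma ffcomp1l (U V : finType) (f : {ffun U -> V}) :
  ffcomp [ffun x => x] f = f.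
Proof. by apply/ffunP => u; rewrite !ffunE. Qed.

Lemma ffcomp1r (U V : finType) (f : {ffun U -> V}) :
  ffcomp f [ffun x => x] = f.
Proof. by apply/ffunP => u; rewrite !ffunE. Qed.

Lemma FS_compA (X Y Z T : finType) (h : surjection Z T) (g : surjection Y Z)
  (f : surjection X Y) : FS_comp h (FS_comp g f) = FS_comp (FS_comp h g) f.
Proof. exact/val_inj/ffcompA. Qed.

Lemma FS_comp1l (X Y : finType) (f : surjection X Y) : FS_comp (FS_id Y) f = f.
Proof. exact/val_inj/ffcomp1l. Qed.

Lemma FS_comp1r (X Y : finType) (f : surjection X Y) : FS_comp f (FS_id X) = f.
Proof. exact/val_inj/ffcomp1r. Qed.

Definition FS : fincat := FinCat FS_compA FS_comp1l FS_comp1r.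

Lemma FI_compA (X Y Z T : finType) (h : injection Z T) (g : injection Y Z)
  (f : injection X Y) : FI_comp h (FI_comp g f) = FI_comp (FI_comp h g) f.
Proof. exact/val_inj/ffcompA. Qed.

Lemma FI_comp1l (X Y : finType) (f : injection X Y) : FI_comp (FI_id Y) f = f.
Proof. exact/val_inj/ffcomp1l. Qed.

Lemma FI_comp1r (X Y : finType) (f : injection X Y) : FI_comp f (FI_id X) = f.
Proof. exact/val_inj/ffcomp1r. Qed.

Definition FI : fincat := FinCat FI_compA FI_comp1l FI_comp1r.

Section Restriction.

Variable k : fieldType.

Definition kFS : klincat k := lin_cat k FS.
Definition kFIop : klincat k := lin_cat k (op_cat FI).

Definition restr_basis (U X V : finType) (i : injection V U)
    (f : surjection U X) : @khom k kFS V X :=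
  if insub (ffcomp (val f) (val i)) is Some g
  then lin_basis k (C := FS) g else 0.

Definition restr (U X V : finType) (i : injection V U)
    (x : @khom k kFS U X) : @khom k kFS V X :=
  \sum_(f : surjection U X) x f *: restr_basis i f.

Definition kFSt (t : int) (U X : kFS) : {pred khom U X} := fun x =>
  `[< forall (V : finType) (i : injection V U),
        #|U|%:Z - #|V|%:Z = t + 1 -> restr i x = 0 >].

End Restriction.

(* Main.v *)
(* A function h : V -> U induces h^* : kFS(U, X) -> kFS(V, X), sending [f] to
   [f \o h] if f \o h is surjective and to 0 otherwise.  As f \o h \o h' is not
   surjective when f \o h is not, this is functorial for all functions, and it
   covers both restriction (h injective) and precomposition (h surjective).
   Factoring h through a subset of U of the right cardinality, x in kFS^t is
   killed by every h whose image misses more than t points.  In particular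
   y in kFS^0 is killed by f \o i as soon as it is not surjective, and this is
   exactly what is needed for i^*(y [f]) = y (i^* [f]); everything follows from
   this compatibility and from functoriality. *)
Require Import Defs.
From HB Require Import structures.
From mathcomp Require Import all_boot all_order all_algebra.
From mathcomp Require Import boolp.

Set Implicit Arguments.
Unset Strict Implicit.
Unset Printing Implicit Defensive.

Import Order.TTheory GRing.Theory Num.Theory.
Local Open Scope ring_scope.

(** * Preliminaries on finite sets and linear maps *)

Lemma superset_of_card (T : finType) (A : {set T}) (m : nat) :
  (#|A| <= m <= #|T|)%N -> exists2 S : {set T}, A \subset S & #|S| = m.
Proof.
case/andP=> /subnKC <-; elim: (m - #|A|)%N => [|d IH] hT.
  by exists A; rewrite ?addn0.
have [|S AS cS] := IH; first by apply: leq_trans hT; rewrite addnS.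
have /subsetPn[x _ xS] : ~~ ([set: T] \subset S).
  by apply: contraTN hT => /subset_leq_card; rewrite cardsT cS -ltnNge addnS ltnS.
by exists (x |: S); rewrite ?cardsU1 ?xS ?cS ?addnS // subsetU // AS orbT.
Qed.

Lemma linear_map0 (k : fieldType) (V W : lmodType k) (f : V -> W) :
  linear f -> f 0 = 0.
(* The coefficient -1 makes the right-hand side [- f 0 + f 0], which cancels. *)
Proof. by move=> hf; have := hf (-1) 0 0; rewrite scaler0 addr0 scaleN1r addNr. Qed.

Lemma linear_mapZ (k : fieldType) (V W : lmodType k) (f : V -> W) a v :
  linear f -> f (a *: v) = a *: f v.
Proof. by move=> hf; rewrite -[a *: v]addr0 hf linear_map0 // addr0. Qed.

Lemma linear_map_sum (k : fieldType) (V W : lmodType k) (f : V -> W)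
    (I : Type) (r : seq I) (F : I -> V) :
  linear f -> f (\sum_(i <- r) F i) = \sum_(i <- r) f (F i).
Proof.
move=> hf; elim: r => [|i r IH]; first by rewrite !big_nil linear_map0.
by rewrite !big_cons -[F i]scale1r hf IH !scale1r.
Qed.

(** * Pullback along arbitrary functions *)

Section Pullback.

Variable k : fieldType.

Definition basis_or0 (U X : finType) (f : {ffun U -> X}) : @lin_hom k FS U X :=
  if insub f is Some g then lin_basis k (C := FS) g else 0.

Definition pullback (U X V : finType) (h : {ffun V -> U})
    (x : @lin_hom k FS U X) : @lin_hom k FS V X :=
  \sum_(f : surjection U X) x f *: basis_or0 (ffcomp (val f) h).

Lemma basis_or0_surj (U X : finType) (f : surjection U X) :
  basis_or0 (val f) = lin_basis k (C := FS) f.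
Proof. by rewrite /basis_or0 valK. Qed.

Lemma basis_or0_exist (U X : finType) (f : {ffun U -> X}) (sf : surjectiveb f) :
  basis_or0 f = lin_basis k (C := FS) (exist _ f sf : surjection U X).
Proof. exact: (basis_or0_surj (exist _ f sf)). Qed.

Lemma basis_or0_nsurj (U X : finType) (f : {ffun U -> X}) :
  ~~ surjectiveb f -> basis_or0 f = 0.
Proof. by move=> nf; rewrite /basis_or0 insubN. Qed.

Lemma pullback_linear (U X V : finType) (h : {ffun V -> U}) :
  linear (@pullback U X V h).
Proof.
move=> a x y; rewrite /pullback scaler_sumr -big_split; apply: eq_bigr => f _ /=.
by rewrite !ffunE scalerDl scalerA.
Qed.

Lemma pullback_basis (U X V : finType) (h : {ffun V -> U}) (f : surjection U X) :
  pullback h (lin_basis k (C := FS) f) = basis_or0 (ffcomp (val f) h).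
Proof.
rewrite /pullback (bigD1 f) //= big1 => [|g /negPf gf].
  by rewrite ffunE eqxx scale1r addr0.
by rewrite ffunE gf scale0r.
Qed.

Lemma pullback_comp (U X V W : finType) (h : {ffun V -> U}) (h' : {ffun W -> V})
    (x : @lin_hom k FS U X) :
  pullback h' (pullback h x) = pullback (ffcomp h h') x.
Proof.
move: x; apply: lin_ext => [a x y|a x y|f]; rewrite ?pullback_linear //.
rewrite !pullback_basis ffcompA.
have [sfh|nfh] := boolP (surjectiveb (ffcomp (val f) h)).
  by rewrite basis_or0_exist pullback_basis.
rewrite !basis_or0_nsurj ?(linear_map0 (@pullback_linear _ _ _ _)) //.
apply: contra nfh => /surjectivebP sf; apply/surjectivebP => u.
by have [w <-] := sf u; exists (h' w); rewrite !ffunE.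
Qed.

Lemma pullback_id (U X : finType) (x : @lin_hom k FS U X) :
  pullback [ffun u => u] x = x.
Proof.
move: x; apply: lin_ext => [a x y|a x y|f] //; first exact: pullback_linear.
by rewrite pullback_basis ffcomp1r basis_or0_surj.
Qed.

(** Since [g \o f] is always surjective, the zero case of the pullback never occurs. This turns
    postcomposition by [y] into a pullback of [y], to which vanishing results for [y] apply. *)
Lemma lin_comp_basisr (U X Y : finType) (y : @lin_hom k FS X Y)
    (f : surjection U X) :
  lin_comp y (lin_basis k (C := FS) f) = pullback (val f) y.
Proof.
move: y; apply: lin_ext => [a x y|a x y|g].
- exact: (lin_comp_bilinear k (C := FS) U X Y).2.
- exact: pullback_linear.
by rewrite lin_comp_basis pullback_basis (basis_or0_exist (surj_comp g f)).
Qed.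

Lemma restrE (U X V : finType) (i : injection V U) (x : @lin_hom k FS U X) :
  restr i x = pullback (val i) x.
Proof. by []. Qed.

Lemma pullback_kFSt (t : int) (U X V : finType) (h : {ffun V -> U})
    (x : @lin_hom k FS U X) :
    -1 <= t -> x \in @kFSt k t U X ->
    t + 1 <= #|U|%:Z - #|[set h v | v in V]|%:Z -> pullback h x = 0.
Proof.
move=> ht /asboolP hx hU.
have [n tE] : exists n : nat, t + 1 = n%:Z.
  by exists (absz (t + 1)); rewrite gez0_abs // -lerBlDr sub0r.
have hn : (#|[set h v | v in V]| + n <= #|U|)%N.
  by rewrite -lez_nat PoszD -lerBrDl -tE.
have nU : (n <= #|U|)%N by apply: leq_trans hn; rewrite leq_addl.
(* [S] contains the image of [h] and misses exactly [n = t + 1] points, so its inclusion into [U] is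
   one of the injections that kill [x]. *)
have [|S hS cS] := @superset_of_card U [set h v | v in V] (#|U| - n).
  by rewrite leq_subr andbT leq_subRL // addnC.
have memS v : h v \in S by apply: (subsetP hS); apply: imset_f.
pose W : finType := {u : U | u \in S}.
pose h' : {ffun V -> W} := [ffun v => exist _ (h v) (memS v)].
have i_inj : injectiveb [ffun w : W => val w].
  by apply/injectiveP => w w'; rewrite !ffunE => /val_inj.
pose i : injection W U := exist (fun j : {ffun W -> U} => injectiveb j) _ i_inj.
have -> : h = ffcomp (val i) h' by apply/ffunP => v; rewrite !ffunE.
rewrite -pullback_comp -restrE hx ?(linear_map0 (@pullback_linear _ _ _ _)) //.
by rewrite card_sig cS tE -subzn // opprB addrC subrK.
Qed.

Lemma pullback_nsurj (U X V : finType) (h : {ffun V -> U})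
    (x : @lin_hom k FS U X) :
  x \in @kFSt k 0 U X -> ~~ surjectiveb h -> pullback h x = 0.
Proof.
move=> hx nh; apply: (pullback_kFSt _ hx) => //.
(* For [t = 0] the image only has to miss one point; if it missed none, [h] would be surjective. *)
rewrite add0r lerBrDl -PoszD lez_nat addn1 ltnNge.
apply: contra nh => cU; apply/surjectivebP => u.
have /eqP imT : [set h v | v in V] == [set: U] by rewrite eqEcard subsetT cardsT.
have : u \in [set h v | v in V] by rewrite imT inE.
by case/imsetP => v _ ->; exists v.
Qed.

(** On a basis element [[f]] the left side is the pullback of [y] along [f \o h]. The right side is
    the same if [f \o h] is surjective and 0 otherwise; in the latter case [y] in kFS^0 makes the
    left side vanish too. *)
Lemma pullback_lin_comp (U X Y V : finType) (h : {ffun V -> U})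
    (y : @lin_hom k FS X Y) (x : @lin_hom k FS U X) :
  y \in @kFSt k 0 X Y -> pullback h (lin_comp y x) = lin_comp y (pullback h x).
Proof.
move=> hy; have bl V' := (lin_comp_bilinear k (C := FS) V' X Y).1 y.
move: x; apply: lin_ext => [a u v|a u v|f].
- by rewrite bl pullback_linear.
- by rewrite pullback_linear bl.
rewrite lin_comp_basisr pullback_comp pullback_basis.
have [sfh|nfh] := boolP (surjectiveb (ffcomp (val f) h)).
  by rewrite basis_or0_exist lin_comp_basisr.
by rewrite basis_or0_nsurj // (linear_map0 (bl _)) pullback_nsurj.
Qed.

(** * Closure properties of the filtration and the subcategory kFS^0 *)

Lemma kFSt_submod (t : int) (U X : finType) : submod_closed (@kFSt k t U X).
Proof.
split=> [|a x y /asboolP hx /asboolP hy]; apply/asboolP => V i hV.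
  exact: (linear_map0 (@pullback_linear _ _ _ _)).
have := pullback_linear (val i) a x y; rewrite -!restrE hx // hy // => ->.
by rewrite scaler0 addr0.
Qed.

Lemma kFSt_comp (t : int) (U X Y : finType) (y : @lin_hom k FS X Y)
    (x : @lin_hom k FS U X) :
  y \in @kFSt k 0 X Y -> x \in @kFSt k t U X -> lin_comp y x \in @kFSt k t U Y.
Proof.
move=> hy /asboolP hx; apply/asboolP => V i hV.
rewrite restrE pullback_lin_comp // -restrE hx //.
exact: (linear_map0 ((lin_comp_bilinear k (C := FS) V X Y).1 y)).
Qed.

Lemma card_injection (V U : finType) (i : injection V U) :
  #|[set val i v | v in V]| = #|V|.
Proof. by rewrite card_imset //; apply/injectiveP/(valP i). Qed.

(** If [j : W -> V] misses [t + 1] points of [V], then [i \o j] misses at least as many points of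
    [U], because [|V| <= |U|]. *)
Lemma kFSt_restr (t : int) (U X V : finType) (i : injection V U)
    (x : @lin_hom k FS U X) :
  -1 <= t -> x \in @kFSt k t U X -> restr i x \in @kFSt k t V X.
Proof.
move=> ht hx; apply/asboolP => W j hW.
rewrite !restrE pullback_comp; apply: (pullback_kFSt ht hx).
rewrite -[ffcomp _ _]/(val (FI_comp i j)) card_injection -hW lerB // lez_nat.
by rewrite -(card_injection i) max_card.
Qed.

Lemma kFSt_mono (t : int) (U X : finType) :
  -1 <= t -> {subset @kFSt k t U X <= @kFSt k (t + 1) U X}.
Proof.
move=> ht x hx; apply/asboolP => V i hV; rewrite restrE.
by apply: (pullback_kFSt ht hx); rewrite card_injection hV lerDl.
Qed.

Lemma kFSt_N1 (U X : finType) (x : @lin_hom k FS U X) :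
  (x \in @kFSt k (-1) U X) = (x == 0).
Proof.
apply/idP/eqP => [/asboolP hx|->]; last by case: (kFSt_submod (-1) U X).
(* For [t = -1] the test injections have [|V| = |U|], and the identity is one of them. *)
have := hx U (FI_id U); rewrite subrr addNr => /(_ erefl).
by rewrite restrE pullback_id.
Qed.

(** The condition is vacuous, as it would require [|V| = -1]. This makes the filtration
    exhaustive. *)
Lemma kFSt_card (U X : finType) (x : @lin_hom k FS U X) :
  x \in @kFSt k #|U| U X.
Proof.
apply/asboolP => V i /addrI.
by case: #|V|.
Qed.

Lemma wide_kFS0 : wide_linear_subcategory (@kFSt k 0).
Proof.
split=> [U X|X|X Y Z g f]; [exact: kFSt_submod | | exact: kFSt_comp].
(* The identity restricts to [i] itself, which is not surjective because [|V| = |X| - 1]. *)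
apply/asboolP => V i hV; rewrite restrE /= /lin_id pullback_basis basis_or0_nsurj //.
apply/negP => /surjectivebP si.
have : (#|X| <= #|V|)%N.
  rewrite -(card_injection i) -cardsT; apply/subset_leq_card/subsetP => u _.
  have [v <-] := si u; apply/imsetP; exists v => //.
  by rewrite !ffunE.
by rewrite -lez_nat -subr_le0 hV.
Qed.

End Pullback.

(** * The linearized restriction action of FI^op *)

Section Action.

Variable k : fieldType.

Definition lin_restr (X : finType) (U V : finType) (h : @lin_hom k (op_cat FI) U V)
    (x : @lin_hom k FS U X) : @lin_hom k FS V X :=
  \sum_(i : injection V U) h i *: restr i x.

Lemma lin_restr_bilinear (X U V : finType) : bilinear_map (@lin_restr X U V).
Proof.
split=> [h|x] a u v; rewrite /lin_restr scaler_sumr -big_split;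
  apply: eq_bigr => i _ /=.
  by rewrite !restrE pullback_linear scalerDr !scalerA mulrC.
by rewrite !ffunE scalerDl scalerA.
Qed.

Lemma lin_restr_basis (X U V : finType) (i : injection V U)
    (x : @lin_hom k FS U X) :
  lin_restr (@lin_basis k (op_cat FI) U V i) x = restr i x.
Proof.
rewrite /lin_restr (bigD1 i) //= big1 => [|j /negPf ji].
  by rewrite ffunE eqxx scale1r addr0.
by rewrite ffunE ji scale0r.
Qed.

Lemma lin_restr_id (X U : finType) (x : @lin_hom k FS U X) :
  lin_restr (@lin_id k (op_cat FI) U) x = x.
Proof. by rewrite lin_restr_basis restrE pullback_id. Qed.

Lemma lin_restr_comp (X U V W : finType) (h' : @lin_hom k (op_cat FI) V W)
    (h : @lin_hom k (op_cat FI) U V) (x : @lin_hom k FS U X) :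
  lin_restr (lin_comp h' h) x = lin_restr h' (lin_restr h x).
Proof.
have cl := (lin_comp_bilinear k (C := op_cat FI) U V W).1.
have cr := (lin_comp_bilinear k (C := op_cat FI) U V W).2.
have rl A B h0 := (lin_restr_bilinear X A B).1 h0.
have rr A B x0 := (lin_restr_bilinear X A B).2 x0.
move: h'; apply: lin_ext => [a u v|a u v|j]; first by rewrite cr rr.
  exact: rr.
move: h; apply: lin_ext => [a u v|a u v|i]; first by rewrite cl rr.
  by have /= -> := rr _ _ x a u v; apply: rl.
by rewrite lin_comp_basis !lin_restr_basis !restrE pullback_comp.
Qed.

(** The two actions commute; this is what makes them a single action of the tensor product
    category. *)
Lemma lin_restr_lin_comp (U V X Y : finType) (h : @lin_hom k (op_cat FI) U V)
    (y : @lin_hom k FS X Y) (x : @lin_hom k FS U X) :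
  y \in @kFSt k 0 X Y -> lin_restr h (lin_comp y x) = lin_comp y (lin_restr h x).
Proof.
move=> hy; have bl := (lin_comp_bilinear k (C := FS) V X Y).1 y.
rewrite /lin_restr (linear_map_sum _ _ bl); apply: eq_bigr => i _.
by rewrite (linear_mapZ _ _ bl) !restrE pullback_lin_comp.
Qed.

Lemma kFSt_lin_restr (t : int) (U X V : finType) (h : @lin_hom k (op_cat FI) U V)
    (x : @lin_hom k FS U X) :
  -1 <= t -> x \in @kFSt k t U X -> lin_restr h x \in @kFSt k t V X.
Proof.
move=> ht hx; have [S0 SD] := kFSt_submod k t V X.
apply: (big_ind (fun y => y \in @kFSt k t V X)) => // [y z hy hz|i _].
  by rewrite -[y]scale1r SD.
by rewrite -[_ *: _]addr0 SD // kFSt_restr.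
Qed.

(** * The action of the tensor product category *)

Let A := tensor_cat (subcat (wide_kFS0 k)) (kFIop k).
Let M (c : A) : lmodType k := @lin_hom k FS c.2 c.1.

Definition act_pure (c d : A) (x : M c) (g : @sub_hom k (kFS k) _ (wide_kFS0 k) c.1 d.1)
    (h : @lin_hom k (op_cat FI) c.2 d.2) : M d :=
  lin_comp (val g) (lin_restr h x).

Definition tensor_act (c d : A) (s : khom c d) (x : M c) : M d :=
  tens_lift (act_pure x) s.

Lemma act_pure_bilinear (c d : A) (x : M c) : bilinear_map (@act_pure c d x).
Proof.
split=> [g|h] a u v; rewrite /act_pure.
  by rewrite (lin_restr_bilinear _ _ _).2 (lin_comp_bilinear _ _ _ _).1.
by rewrite linearP (lin_comp_bilinear _ _ _ _).2.
Qed.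

Lemma tensor_act_pure (c d : A) g h (x : M c) :
  tensor_act (pure g h : @khom k A c d) x = lin_comp (val g) (lin_restr h x).
Proof. by rewrite /tensor_act tens_lift_pure //; apply: act_pure_bilinear. Qed.

Lemma tensor_act_bilinear (c d : A) : bilinear_map (@tensor_act c d).
Proof.
split=> [s|x]; last exact: (tens_lift_linear (act_pure_bilinear d x)).
(* For fixed [s] the action is a sum over a representative of [s], so linearity in [x] is checked
   summand by summand. *)
move=> a x y; rewrite /tensor_act /tens_lift /formal_eval scaler_sumr -big_split.
apply: eq_bigr => p _ /=; rewrite /act_pure.
by rewrite (lin_restr_bilinear _ _ _).1 (lin_comp_bilinear _ _ _ _).1.
Qed.

Lemma tensor_act_comp (c d e : A) (s : khom d e) (t : khom c d) (x : M c) :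
  tensor_act (kcomp s t) x = tensor_act s (tensor_act t x).
Proof.
have cl := (@tensor_comp_bilinear _ _ _ c d e).1.
have cr := (@tensor_comp_bilinear _ _ _ c d e).2.
have al c' d' := (tensor_act_bilinear c' d').1.
have ar c' d' := (tensor_act_bilinear c' d').2.
move: s; apply: tens_ext => [a u v|a u v|g h].
- by have /= -> := cr t a u v; apply: ar.
- exact: ar.
move: t; apply: tens_ext => [a u v|a u v|g' h'].
- by have /= -> := cl (pure g h) a u v; apply: ar.
- by have /= -> := ar _ _ x a u v; apply: al.
rewrite /= tensor_comp_pure !tensor_act_pure lin_restr_comp.
(* Restriction along [h] has to move past postcomposition by [g'], which is allowed because [g']
   lies in kFS^0. *)
by rewrite lin_restr_lin_comp ?lin_compA //; apply: valP.
Qed.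

Lemma tensor_act_module : is_module tensor_act.
Proof.
split=> [c d|c x|c d e s t x]; [exact: tensor_act_bilinear | |exact: tensor_act_comp].
by rewrite tensor_act_pure lin_restr_id lin_comp1l.
Qed.

Lemma kFSt_submodule (t : int) :
  -1 <= t -> is_submodule tensor_act (fun c => @kFSt k t c.2 c.1).
Proof.
move=> ht; split=> [c|c d s x hx]; first exact: kFSt_submod.
have [S0 SD] := kFSt_submod k t d.2 d.1.
(* The action is a sum over a representative of [s]; each term restricts and then postcomposes by an
   element of kFS^0, and both operations preserve kFS^t. *)
apply: (big_ind (fun y => y \in @kFSt k t d.2 d.1)) => // [y z hy hz|p _].
  by rewrite -[y]scale1r SD.
by apply: kFSt_comp (valP p.1) _; apply: kFSt_lin_restr.
Qed.

End Action.

Theorem theorem1p1 (k : fieldType) (hk : [pchar k] =i pred0) :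
  exists kFS0_wide : wide_linear_subcategory (@kFSt k 0),
  let kFS0 := subcat kFS0_wide in
  let A := tensor_cat kFS0 (kFIop k) in
  let M := fun c : A => @khom k (kFS k) c.2 c.1 in
  exists act : forall c d : A, khom c d -> M c -> M d,
  [/\ is_module act,
      forall (X Y : kFS0) (U : kFIop k) (g : khom X Y) (x : M (X, U)),
        act (X, U) (Y, U) (pure g (kid U)) x = kcomp (val g) x,
      forall (X : kFS0) (U V : finType) (i : injection V U) (x : M (X, U)),
        act (X, U) (X, V) (pure (kid X) (@lin_basis k (op_cat FI) U V i)) x
          = restr i x
    & is_filtration act (fun t c => @kFSt k t c.2 c.1)].
Proof.
exists (wide_kFS0 k); exists (@tensor_act k); split.
- exact: tensor_act_module.
- by move=> X Y U g x; rewrite tensor_act_pure lin_restr_id.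
- by move=> X U V i x; rewrite tensor_act_pure lin_comp1l lin_restr_basis.
split=> [c x|t ht|t ht c|c x].
- exact: kFSt_N1.
- exact: kFSt_submodule.
- exact: kFSt_mono.
- by exists #|c.2|%:Z; [| exact: kFSt_card].
Qed.
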